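(* Every separable compact line $K$ of topological weight $w(K)\ge \mathrm{non}(\mathcal{E})$ has a countable discrete extension $L$ without property $(\mathcal{E})$, i.e. such that there is no bounded extension operator $E:C(K)\to C(L)$.
   Context: All topological spaces are Hausdorff. A compact line is a compact space whose topology is the order topology of some linear order. A countable discrete extension of a compact space $K$ is a compact space $L\supseteq K$ (containing $K$ as a subspace) such that $L\setminus K$ is a countably infinite discrete set. $C(K)$ is the Banach space of real-valued continuous functions on $K$ with the supremum norm. For compact spaces $K\subseteq L$, an extension operator is a bounded linear operator $E:C(K)\to C(L)$ such that $(Ef)|_K=f$ for every $f\in C(K)$. A countable discrete extension $L$ of $K$ has property $(\mathcal{E})$ if there is a (bounded) extension operator $C(K)\to C(L)$. The cardinal $\mathrm{non}(\mathcal{E})$ is the least cardinality of a subset of the Cantor set $2^\omega$ that cannot be covered by countably many closed sets of measure zero, with respect to the standard product measure on $2^\omega$ (equivalently, the least cardinality of a subset of $[0,1]$ that cannot be covered by countably many closed Lebesgue null sets). *)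

(* Defs.v *)
From HB Require Import structures.
From mathcomp Require Import all_boot all_order all_algebra.
From mathcomp Require Import all_classical all_reals all_analysis.

Set Implicit Arguments.
Unset Strict Implicit.
Unset Printing Implicit Defensive.

Import Order.TTheory GRing.Theory Num.Theory.
Import numFieldNormedType.Exports.

Local Open Scope classical_set_scope.
Local Open Scope card_scope.
Local Open Scope ring_scope.

Definition separable_space (T : topologicalType) : Prop :=
  exists2 D : set T, countable D & dense D.

(* There is no type of cardinals in the library: the weight of [T] is the
   cardinality of a base [B] such that [weight_attained B]. *)
Definition weight_attained (T : topologicalType) (B : set (set T)) : Prop :=
  basis B /\ forall B' : set (set T), basis B' -> B #<= B'.

Definition cylinder (s : seq bool) : set cantor_space :=
  [set x : cantor_space | forall i, (i < size s)%N -> x i = nth false s i].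

(* The standard product measure on 2^omega, as the outer measure generated by
   the premeasure [cylinder s |-> 2^-(size s)]; on Borel sets it agrees with
   the product measure. *)
Definition cantor_measure (R : realType) (A : set cantor_space) : \bar R :=
  ereal_inf [set (\sum_(0 <= k <oo) ((2^-1 ^+ size (s k))%:E : \bar R))%E
            | s in [set s : nat -> seq bool |
                    A `<=` \bigcup_k cylinder (s k)]].

Definition closed_null_covered (R : realType) (X : set cantor_space) : Prop :=
  exists2 F : nat -> set cantor_space,
    forall n, closed (F n) /\ cantor_measure R (F n) = 0%E &
    X `<=` \bigcup_n F n.

(* The cardinal non(E) is the cardinality of any such [X]. *)
Definition nonE_attained (R : realType) (X : set cantor_space) : Prop :=
  ~ closed_null_covered R X /\
  forall Y : set cantor_space, ~ closed_null_covered R Y -> X #<= Y.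

(* [L] contains [K] as a subspace through the topological embedding [i]. *)
Definition countable_discrete_extension (K L : topologicalType) (i : K -> L)
    : Prop :=
  [/\ compact [set: L] /\ hausdorff_space L,
      injective i,
      forall U : set K, open U <-> exists2 V : set L, open V & i @^-1` V = U,
      ~` range i #= [set: nat] &
      isolated (~` range i) = ~` range i].

(* Meaningful for bounded [f], in particular for continuous [f] on a compact
   space. *)
Definition sup_norm (R : realType) (T : Type) (f : T -> R) : R :=
  sup [set `|f x| | x in [set: T]].

(* [E] is considered only on C(K); its values on discontinuous functions are
   irrelevant. *)
Definition extension_operator (R : realType) (K L : topologicalType)
    (i : K -> L) (E : (K -> R) -> (L -> R)) : Prop :=
  [/\ forall f : K -> R, continuous f -> continuous (E f),
      forall (a : R) (f g : K -> R), continuous f -> continuous g ->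
        E (a *: f + g) = a *: E f + E g,
      exists M : R, forall f : K -> R, continuous f ->
        sup_norm (E f) <= M * sup_norm f &
      forall f : K -> R, continuous f -> E f \o i = f].

Definition property_E (R : realType) (K L : topologicalType) (i : K -> L)
    : Prop :=
  exists E : (K -> R) -> (L -> R), extension_operator i E.

(* Main.v *)
(* A jump is a point [y] with an immediate successor; then [{z | z <= y}] is
   clopen.  Few sets of jumps would give a small basis, so [w(K) >= non(E)]
   yields a map [h] from the jumps to the Cantor set whose range is not covered
   by countably many closed null sets.  With [e] a dense sequence, the isolated
   points of [L] are the triples [k = (n, j, i)] with [j, i < n]; [k] sits at
   [e j] inside the gap above [e j] left by [e 0, ..., e (n-1)].  The clopen set
   [{z <= y}] is extended to [L] by the [k] lying to the left of the gap of [y],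
   together with those in the gap of [y] for which the [i]-th bit of the [n]-th
   block of [h y] is 1.  Distinct jumps eventually lie in distinct gaps, so these
   sets form a chain modulo finite sets and [L] is compact.

   If [E] were an extension operator of norm [M], the values of
   [E 1_{z <= y}] at [k] would determine the bits of [h y] at all levels
   [n >= m(y)].  As a function of [y] they have variation at most [M], so inside
   one gap only O(M n) patterns of length [n] occur, and O(M n^2) at level [n]
   altogether, which is at most half of the [2^n] patterns.  Hence
   [{h y | m(y) <= m}] lies in a closed null set for each [m]. *)
Require Import Defs.
From HB Require Import structures.
From mathcomp Require Import all_boot all_order all_algebra.
From mathcomp Require Import all_classical all_reals all_analysis.
From mathcomp Require Import zify lra.
Import numFieldNormedType.Exports.
Local Open Scope classical_set_scope.
Local Open Scope card_scope.
Local Open Scope ring_scope.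

Set Implicit Arguments.
Unset Strict Implicit.
Unset Printing Implicit Defensive.

Import Order.TTheory GRing.Theory Num.Theory.

(** * The extension *)

(** The inductive form lets convergence be checked on the subbase alone, by induction on how an open
    set is built. *)
Inductive generated_open (T : Type) (S : set (set T)) : set T -> Prop :=
| generated_sub A : S A -> generated_open S A
| generated_setT : generated_open S setT
| generated_setI A B :
    generated_open S A -> generated_open S B -> generated_open S (A `&` B)
| generated_bigcup (I : Type) (f : I -> set T) :
    (forall i, generated_open S (f i)) -> generated_open S (\bigcup_i f i).

Definition jump (d : Order.disp_t) (K : orderType d) (y : K) : Prop :=
  exists2 z : K, (y < z)%O & forall w : K, (y < w)%O -> (z <= w)%O.

Definition triple : Type := {n : nat & ('I_n * 'I_n)%type}.
HB.instance Definition _ := Countable.on triple.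

(* [e] and [h] only matter for the topology put on this type below. *)
Definition ext_space (d : Order.disp_t) (K : orderTopologicalType d)
    (e : nat -> K) (h : K -> nat -> bool) : Type := (K + triple)%type.
HB.instance Definition _ (d : Order.disp_t) (K : orderTopologicalType d)
  (e : nat -> K) (h : K -> nat -> bool) := Choice.on (ext_space e h).

Section Extension.
Variables (d : Order.disp_t) (K : orderTopologicalType d).
Variables (e : nat -> K) (h : K -> nat -> bool).
Local Notation ext := (ext_space e h).

Definition anchor (k : triple) : K := e (tagged k).1.

(** The anchor is the largest among the first [tag k] terms of [e] that are at most [y]: these [y]
    fill the half-open gap from the anchor up to the next of these terms. *)
Definition cell (k : triple) (y : K) : bool :=
  (anchor k <= y)%O &&
  [forall j : 'I_(tag k), (e j <= y)%O ==> (e j <= anchor k)%O].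

(* The blocks [['C(n, 2), 'C(n, 2) + n)] partition the natural numbers. *)
Definition digit (k : triple) : nat := ('C(tag k, 2) + (tagged k).2)%N.

Definition left_of (k : triple) (y : K) : bool :=
  (anchor k <= y)%O && (cell k y ==> h y (digit k)).

Definition spot (p : ext) : K :=
  match p with inl z => z | inr k => anchor k end.

Definition low (x : K) : set ext := [set p | (spot p < x)%O].

Definition high (x : K) : set ext := [set p | (x < spot p)%O].

Definition left_cut (y : K) : set ext :=
  [set p | match p with inl z => (z <= y)%O | inr k => left_of k y end].

(** Anchors lie at or below the points of their cells, so [low x] is harmless for every [x]. At a
    jump [x] the set [high x] would be a neighbourhood of the successor of [x] that misses all
    triples in the cells of [x], although those with bit 0 may accumulate there; hence the
    restriction to non-jumps. *)
Inductive ext_subbase : set ext -> Prop :=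
| sub_low x : ext_subbase (low x)
| sub_high x : ~ jump x -> ext_subbase (high x)
| sub_cut y : jump y -> ext_subbase (left_cut y)
| sub_cutC y : jump y -> ext_subbase (~` left_cut y)
| sub_point k : ext_subbase [set (inr k : ext)]
| sub_pointC k : ext_subbase (~` [set (inr k : ext)]).

HB.instance Definition _ := isOpenTopological.Build ext
  (generated_setT ext_subbase)
  (@generated_setI _ ext_subbase)
  (@generated_bigcup _ ext_subbase).

Lemma ext_subbase_open A : ext_subbase A -> open (A : set ext).
Proof. exact: generated_sub. Qed.

Lemma ext_cvg (F : set_system ext) (p : ext) : Filter F ->
  (forall A, ext_subbase A -> A p -> F A) -> F --> p.
Proof.
move=> FF FS; suff gen A : generated_open ext_subbase A -> A p -> F A.
  move=> U [A [opA Ap AU]]; apply: filterS AU _; exact: gen.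
elim=> {A} [A SA|_|A B _ IA _ IB [Ap Bp]|I f _ If [i _ fip]].
- exact: FS.
- exact: filterT.
- exact: filterI (IA Ap) (IB Bp).
- by apply: filterS (If i fip) => q fiq; exists i.
Qed.

Lemma finite_triples n : finite_set [set k : triple | (tag k <= n)%N].
Proof.
have -> : [set k : triple | (tag k <= n)%N] =
    \bigcup_(m in [set m | (m <= n)%N])
      range (existT (fun m => ('I_m * 'I_m)%type) m).
  apply/seteqP; split => [[m ij] /= mn|_ [m mn [ij _ <-]]//].
  by exists m => //; exists ij.
apply: bigcup_finite => [|m _]; last exact/finite_image/finite_finset.
by apply: sub_finite_set (finite_II n.+1) => m.
Qed.

Hypothesis dense_e : dense (range e).

Lemma dense_itv (x y z : K) : (x < y)%O -> (y < z)%O ->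
  exists j, (x < e j)%O /\ (e j < z)%O.
Proof.
move=> xy yz; have [|w [xwz [j _ ejw]]] := dense_e _ (itv_open x z).
  by exists y; rewrite /= in_itv /= xy.
by move: xwz; rewrite -ejw /= in_itv => /andP[? ?]; exists j.
Qed.

(** The open interval from [y] to the successor of [y'] contains [y'], so it is nonempty and meets
    the dense sequence. Once that term is among the first [n], the points [y] and [y'] are in
    different cells of level [n]. *)
Lemma jump_separated y y' : jump y' -> (y < y')%O ->
  exists j, (y < e j)%O /\ (e j <= y')%O.
Proof.
move=> [z' yz' min'] yy'; have [j [yj jz]] := dense_itv yy' yz'.
by exists j; split => //; case: leP => // /min'; rewrite leNgt jz.
Qed.

(** An ultrafilter without a singleton of a triple avoids the finitely many triples of each bounded
    level, so [tag k] tends to infinity along it. This absorbs all finite exceptions below. *)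
Lemma ext_compact : compact [set: K] -> compact [set: ext].
Proof.
move=> cptK; rewrite compact_ultra => F FU _.
have PF : ProperFilter F := ultra_proper.
have FF : Filter F by exact: filter_filter.
have ultraC A : ~ F A -> F (~` A).
  by case: (in_ultra_setVsetC A FU).
have [[k Fk]|noF] := pselect (exists k, F [set (inr k : ext)]).
  exists (inr k); split=> //; apply: ext_cvg => A _ Ak.
  by apply: filterS Fk => _ ->.
have FC k : F (~` [set (inr k : ext)]) by apply: ultraC => Fk; apply: noF; exists k.
have Flevel n : F [set p | forall k, p = inr k -> (n < tag k)%N].
  have /finite_fsetP[X XE] := finite_triples n.
  have := @filter_bigI _ _ X (fun k => ~` [set (inr k : ext)]) F FF
    (fun k _ => FC k).
  move=> FX; apply: filterS FX => p pX k pk; rewrite ltnNge; apply/negP => kn.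
  by apply: (pX k) => //; rewrite -XE.
(* An ultrafilter living in the gap of a jump converges to one of the two end
   points of that gap; any other one converges to a limit of the anchors. *)
have [[y [jy Fy]]|nocell] := pselect (exists y : K, jump y /\
    F [set p | exists2 k, p = inr k & cell k y]).
  (* Beyond level [j] the term [e j] competes for the anchor, so the anchors in the cells of [y]
     eventually pass every [e j] that is at most [y]. *)
  have Fge j : (e j <= y)%O ->
      F [set p | exists k, [/\ p = inr k, cell k y & (e j <= anchor k)%O]].
    move=> ejy; apply: filterS2 Fy (Flevel j) => p [k -> ck] /(_ _ erefl) jk.
    exists k; split=> //; case/andP: (ck) => _ /forallP /(_ (Ordinal jk)).
    by rewrite /= ejy.
  have [z yz zmin] := jy.
  have lezy x : (x < z)%O -> (x <= y)%O.
    by move=> xz; case: leP => // /zmin; rewrite leNgt xz.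
  (* The ultrafilter contains [left_cut y] or its complement; the limit is [y] in the first case and
     the successor [z] in the second. *)
  have [t [yt tz Fcut FcutC]] : exists t, [/\ (y <= t)%O, (t <= z)%O,
      (t = y -> F (left_cut y)) & ((y < t)%O -> t = z /\ F (~` left_cut y))].
    have [Fc|/ultraC Fc] := pselect (F (left_cut y)).
      by exists y; split=> //; [exact: ltW|rewrite ltxx].
    by exists z; split=> //; [exact: ltW|move=> zy; move: yz; rewrite zy ltxx].
  exists (inl t); split=> //; apply: ext_cvg => _ [x|x njx|y' jy'|y' jy'|k|k] //=.
  - rewrite /low /= => tx; apply: filterS Fy => _ [k -> /andP[ky _]] /=.
    exact: le_lt_trans ky (le_lt_trans yt tx).
  - rewrite /high /= => xt.
    have xy : (x < y)%O.
      rewrite lt_neqAle lezy ?(lt_le_trans xt)// andbT.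
      by apply/eqP => xy; apply: njx; rewrite xy.
    have [j [xj /lezy jy']] := dense_itv xy yz.
    apply: filterS (Fge j jy') => _ [k [-> _ jk]] /=; exact: lt_le_trans xj jk.
  - rewrite /left_cut /= => ty'.
    have [yy'|yy'] := eqVneq y y'.
      by rewrite -yy'; apply: Fcut; apply/eqP; rewrite eq_le yt yy' ty'.
    have lyy' : (y < y')%O by rewrite lt_neqAle yy' (le_trans yt).
    (* From level [j] on, the triples in the cell of [y] are outside the cell of [y'], where no bit
       of [h y'] is consulted. *)
    have [j [yj jy1]] := jump_separated jy' lyy'.
    apply: filterS2 Fy (Flevel j) => p [k -> ck] /(_ _ erefl) jk.
    have ky : (anchor k <= y)%O by case/andP: ck.
    rewrite /= /left_of (le_trans ky (ltW lyy')) /=.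
    suff -> : cell k y' = false by [].
    apply/negP => /andP[_ /forallP /(_ (Ordinal jk))] /=.
    by rewrite jy1 /= leNgt (le_lt_trans ky yj).
  - rewrite /left_cut /= => /negP; rewrite -ltNge => y't.
    have [yy'|yy'] := eqVneq y y'.
      by rewrite -yy'; have [|_] := FcutC; rewrite ?yy'.
    have y'y : (y' < y)%O.
      rewrite lt_neqAle eq_sym yy' /=; move: y't; rewrite le_eqVlt in yt.
      case/orP: yt => [/eqP <- /ltW//|yt]; have [-> _] := FcutC yt.
      exact: lezy.
    have [j [xj /lezy jy1]] := dense_itv y'y yz.
    apply: filterS (Fge j jy1) => _ [k [-> _ jk]] /=; apply/negP.
    by rewrite /left_of leNgt (lt_le_trans xj jk).
(* A cluster point of the image under [spot] is even a limit, because [F] is an ultrafilter; this is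
   [Fspot]. *)
have [|t [_ clt]] := cptK (spot @ F) _.
  exact: filterT.
have Fspot (U : set K) : open U -> U t -> F (spot @^-1` U).
  move=> oU Ut; apply: contrapT => /ultraC FU'.
  have := clt (~` U) U; case=> //; last by move=> q [].
  by apply: open_nbhs_nbhs; split.
exists (inl t); split=> //; apply: ext_cvg => _ [x|x njx|y' jy'|y' jy'|k|k] //=.
- rewrite /low /= => tx; have := Fspot _ (@lray_open _ K x).
  rewrite /= in_itv /= => /(_ tx) FX; apply: filterS FX => p /=.
  by rewrite in_itv.
- rewrite /high /= => tx; have := Fspot _ (@rray_open _ K x).
  rewrite /= in_itv /= andbT => /(_ tx) FX; apply: filterS FX => p /=.
  by rewrite in_itv /= andbT.
- rewrite /left_cut /= => ty; have [z yz zmin] := jy'.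
  have lezy x : (x < z)%O -> (x <= y')%O.
    by move=> xz; case: leP => // /zmin; rewrite leNgt xz.
  have Fz : F (spot @^-1` `]-oo, z[).
    by apply: Fspot; [exact: lray_open|rewrite /= in_itv /= (le_lt_trans ty)].
  have Fnc : F (~` [set p | exists2 k, p = inr k & cell k y']).
    by apply: ultraC => Fc; apply: nocell; exists y'.
  apply: filterS2 Fz Fnc => -[w|k] /=; rewrite in_itv/=; first by move=> /lezy.
  move=> /lezy ky nck; rewrite /left_of ky /=; apply/implyP => ck.
  by case: nck; exists k.
- rewrite /left_cut /= => /negP; rewrite -ltNge => yt.
  have := Fspot _ (@rray_open _ K y').
  rewrite /= in_itv /= andbT => /(_ yt) FX; apply: filterS FX => -[w|k] /=.
    by rewrite in_itv /= andbT => yw; apply/negP; rewrite -ltNge.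
  rewrite in_itv /= andbT => yk; apply/negP; rewrite /left_of.
  by rewrite leNgt yk.
Qed.

Lemma separation_from (T : topologicalType) (p q : T) (A B : set T) :
  open A -> open B -> A p -> B q -> A `&` B = set0 -> ~ cluster (nbhs p) q.
Proof.
move=> oA oB Ap Bq AB clpq.
have [||r] := clpq A B; try exact: open_nbhs_nbhs.
by rewrite AB.
Qed.

(** For [x < y] in [K], either a jump [w] with [x <= w < y] supplies the clopen [left_cut w], or [x]
    is not a jump and some non-jump [z] strictly between gives [low z] and [high z]. Triples are
    clopen points. *)
Lemma ext_hausdorff : hausdorff_space ext.
Proof.
suff sepr k q : inr k <> q :> ext ->
    ~ cluster (nbhs (inr k : ext)) q /\ ~ cluster (nbhs q) (inr k).
  suff sepl (x y : K) : (x < y)%O -> ~ cluster (nbhs (inl x : ext)) (inl y)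
      /\ ~ cluster (nbhs (inl y : ext)) (inl x).
    move=> p q cl; apply: contrapT => pq; move: p q cl pq.
    move=> [x|k] [y|k'] cl pq.
    - have [xy|xy|xy] := ltgtP x y.
      + by have [] := sepl _ _ xy.
      + by have [] := sepl _ _ xy.
      + by apply: pq; rewrite xy.
    - by have [|] := sepr k' (inl x).
    - by have [|] := sepr k (inl y).
    - by have [|] := sepr k (inr k').
  move=> xy.
  suff [A [B [oA oB Ax By AB]]] : exists A B : set ext,
      [/\ open A, open B, A (inl x), B (inl y) & A `&` B = set0].
    by split; [|rewrite setIC in AB]; exact: (separation_from _ _ _ _ AB).
  have [[w jw /andP[xw wy]]|nojump] := pselect
      (exists2 w : K, jump w & (x <= w < y)%O).
    exists (left_cut w), (~` left_cut w); split; last exact: setICr.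
    - exact/ext_subbase_open/sub_cut.
    - exact/ext_subbase_open/sub_cutC.
    - by [].
    - by apply/negP; rewrite -ltNge.
  have [z xz zy] : exists2 z : K, (x < z)%O & (z < y)%O.
    apply: contrapT => nz; apply: nojump; exists x; last by rewrite lexx.
    by exists y => // w xw; case: leP => // wy; case: nz; exists w.
  exists (low z), (high z); split => //.
  - exact/ext_subbase_open/sub_low.
  - apply/ext_subbase_open/sub_high => jz; apply: nojump; exists z => //.
    by rewrite (ltW xz).
  - by apply/seteqP; split => // p [/= pz] /(lt_trans pz); rewrite ltxx.
move=> kq.
have okq := ext_subbase_open (sub_point k).
have okC := ext_subbase_open (sub_pointC k).
split; [apply: (separation_from okq okC)|apply: (separation_from okC okq)];
  rewrite ?setICr ?setICl//; exact/nesym.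
Qed.

Lemma inl_continuous : continuous (inl : K -> ext).
Proof.
move=> x; apply: ext_cvg => _ [y|y njy|y [z yz zmin]|y jy|k|k] /=.
- rewrite /low /= => xy; apply: open_nbhs_nbhs; split => //.
  suff -> : inl @^-1` low y = `]-oo, y[%classic by exact: lray_open.
  by apply/seteqP; split => w; rewrite /= in_itv.
- rewrite /high /= => xy; apply: open_nbhs_nbhs; split => //.
  suff -> : inl @^-1` high y = `]y, +oo[%classic by exact: rray_open.
  by apply/seteqP; split => w; rewrite /= in_itv /= andbT.
- move=> xy; apply: open_nbhs_nbhs; split => //.
  suff -> : inl @^-1` left_cut y = `]-oo, z[%classic by exact: lray_open.
  apply/seteqP; split => w; rewrite /= in_itv /= => wy.
    exact: le_lt_trans wy yz.
  by case: leP => // /zmin; rewrite leNgt wy.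
- move=> xy; apply: open_nbhs_nbhs; split => //.
  suff -> : inl @^-1` (~` left_cut y) = `]y, +oo[%classic by exact: rray_open.
  by apply/seteqP; split => w; rewrite /= in_itv /= andbT ltNge => /negP.
- by [].
- by move=> _; apply: filterE.
Qed.

Lemma range_inlC : ~` range (inl : K -> ext) = range inr.
Proof.
apply/seteqP; split => [[x|k] /= nx|_ [k _ <-] [x _]//].
  by case: nx; exists x.
by exists k.
Qed.

Lemma triples_card : [set: triple] #= [set: nat].
Proof.
apply: eq_card_nat; first exact: countableP.
pose f (n : nat) : triple := existT _ n.+1 (ord0, ord0).
apply/infiniteP; apply: card_le_trans (subset_card_le (@subsetT _ (range f))).
have /inj_card_eq : {in [set: nat] &, injective f}.
  by move=> m n _ _ /(congr1 (fun k => tag k)) [].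
by rewrite card_eq_le => /andP[].
Qed.

Lemma ext_extension : compact [set: K] ->
  countable_discrete_extension (inl : K -> ext).
Proof.
move=> cptK; split.
- by split; [exact: ext_compact|exact: ext_hausdorff].
- by move=> x y [].
- move=> U; split=> [oU|[V oV <-]]; last first.
    by apply: open_comp oV => x _; exact: inl_continuous.
  (* [inl] is a closed map, going from a compact space to a Hausdorff one. *)
  exists (~` (inl @` (~` U))); last first.
    apply/seteqP; split => x /=.
      by move=> nx; apply: contrapT => Ux; apply: nx; exists x.
    by move=> Ux [y nUy [yx]]; apply: nUy; rewrite yx.
  rewrite openC; apply: compact_closed; first exact: ext_hausdorff.
  apply: continuous_compact; first exact/continuous_subspaceT/inl_continuous.
  by apply: subclosed_compact cptK _ => //; exact: open_closedC.
- rewrite range_inlC; apply: card_eq_trans triples_card.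
  by apply: inj_card_eq => i j _ _ [].
- apply/seteqP; split; first exact: isolatedS.
  rewrite range_inlC => _ [k _ <-].
  split; first by apply/mem_set; exists k.
  exists [set (inr k : ext)]; last first.
    by apply/seteqP; split => [_ []//|_ ->]; split=> //; exists k.
  by apply: open_nbhs_nbhs; split=> //; exact/ext_subbase_open/sub_point.
Qed.

(** Otherwise triples outside [W] of unbounded level would have a cluster point; it cannot lie in
    [K], which is inside the open [W], nor be an isolated point. *)
Lemma finite_outside (W : set ext) : compact [set: K] ->
  open W -> range inl `<=` W -> exists n, forall k, (n <= tag k)%N -> W (inr k).
Proof.
move=> cptK oW KW; apply: contrapT => nW.
have /choice[k_ k_P] n : exists k, (n <= tag k)%N /\ ~ W (inr k).
  apply: contrapT => nk; apply: nW; exists n => k nk'.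
  by apply: contrapT => Wk; apply: nk; exists k.
have cptL := ext_compact cptK.
have [|[x|k] [_ clp]] := cptL ((fun n => inr (k_ n) : ext) @ \oo) _.
- exact: filterT.
- have [||_ [[n _ <-] Wn]] := clp (range (fun n => inr (k_ n) : ext)) W.
  + by exists 0%N => // n _; exists n.
  + by apply: open_nbhs_nbhs; split=> //; apply: KW; exists x.
  + by have [_] := k_P n; apply.
- have [||_ [[n kn <-] [nk]]] := clp
    [set (inr (k_ n) : ext) | n in [set n | (tag k < n)%N]] [set (inr k : ext)].
  + by exists (tag k).+1 => // n /= kn; exists n.
  + by apply: open_nbhs_nbhs; split=> //; exact/ext_subbase_open/sub_point.
  + by have [] := k_P n; rewrite nk leqNgt kn.
Qed.

End Extension.

(** * Closed null sets in the Cantor space *)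

Lemma cantor_measure_eq0 (R : realType) (A : set cantor_space) :
  (forall j, exists2 T : seq (seq bool),
     exists2 N, {in T, forall s, size s = N} & (size T * 2 ^ j <= 2 ^ N)%N &
     forall z, A z -> exists2 s, s \in T & cylinder s z) ->
  cantor_measure R A = 0%E.
Proof.
move=> covA; apply/eqP; rewrite eq_le; apply/andP; split; last first.
  apply: le_ereal_inf_tmp => _ [s _ <-]; apply: nneseries_ge0 => k _ _.
  by rewrite lee_fin exprn_ge0 // invr_ge0.
apply/lee_addgt0Pr => eps eps0; rewrite add0e.
have e2 : 0 < eps / 2 by rewrite divr_gt0.
have [j jeps] : exists j, (2^-1 : R) ^+ j < eps / 2.
  exists (Num.bound (eps / 2)^-1).
  rewrite exprVn invf_plt ?posrE ?exprn_gt0//; exact: upper_nthrootP.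
have [T [N TN sT] AT] := covA j.
(* The cover must be an infinite sequence: the finite list is padded by cylinders of measure
   [2^-(j + k + 1)], which add less than [eps / 2] in total. *)
pose s k := if (k < size T)%N then nth [::] T k else nseq (j + k.+1)%N false.
apply: (@le_trans _ _ (\sum_(0 <= k <oo) ((2^-1 ^+ size (s k))%:E : \bar R))%E).
  apply: ereal_inf_lbound; exists s => // z /AT[t tT zt].
  exists (index t T) => //; rewrite /s index_mem tT nth_index //.
apply: (@le_trans _ _ (\sum_(0 <= k <oo)
   ((if (k < size T)%N then (2^-1 ^+ N)%:E else 0) +
     (eps / 2 / (2 ^ k.+1)%:R)%:E : \bar R))%E).
  apply: lee_nneseries => [k _ _|k _]; first by rewrite lee_fin exprn_ge0// invr_ge0.
  rewrite /s; case: ifPn => [kT|_].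
    rewrite TN ?mem_nth // -EFinD lee_fin lerDl divr_ge0 ?ltW//.
  rewrite add0e lee_fin size_nseq exprD natrX -exprVn.
  by rewrite ler_wpM2r ?exprn_ge0 ?invr_ge0// ltW.
apply: le_trans (epsilon_trick _ _ _) _ => //; rewrite ?ltW//.
  by move=> k; case: ifP => // _; rewrite lee_fin exprn_ge0// invr_ge0.
rewrite (@nneseries_split _ _ 0 (size T)); last first.
  by move=> k _; case: ifP => // _; rewrite lee_fin exprn_ge0// invr_ge0.
rewrite [X in (_ + X + _)%E]eseries0 ?adde0; last first.
  by move=> k; rewrite add0n ltnNge => -> _.
rewrite add0n big_nat (eq_bigr (fun=> (2^-1 ^+ N)%:E)); last first.
  by move=> k /andP[_ ->].
rewrite -big_nat sumEFin -EFinD lte_fin sumr_const_nat subn0.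
rewrite [ltRHS](splitr eps) ltrD2r; apply: le_lt_trans jeps.
rewrite !exprVn -[leLHS]mulr_natl ler_pdivrMr ?exprn_gt0// mulrC.
rewrite ler_pdivlMr ?exprn_gt0//.
by rewrite -!natrX -natrM ler_nat.
Qed.

Lemma cylinder_nbhs (z : cantor_space) N : nbhs z (cylinder (mkseq z N)).
Proof.
elim: N => [|N IHN]; first exact: filterE.
have zN : nbhs z (proj N @^-1` [set z N]).
  by apply: (@proj_continuous _ (fun _ : nat => bool) N z); exact: discrete_set1.
apply: filterS2 IHN zN => x + xN i; rewrite !size_mkseq => xz iN.
have [iN'|iN'] := ltnP i N.
  by rewrite xz ?size_mkseq // !nth_mkseq // ltnS ltnW.
by have -> : i = N; [apply/eqP; rewrite eqn_leq iN' -ltnS iN|rewrite nth_mkseq].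
Qed.

Lemma cylinder_mkseq (z x : cantor_space) N :
  cylinder (mkseq z N) x -> mkseq x N = mkseq z N.
Proof.
move=> zx; apply: (@eq_from_nth _ false); rewrite ?size_mkseq // => i iN.
by rewrite nth_mkseq// zx ?size_mkseq.
Qed.

Definition block (z : nat -> bool) n : seq bool :=
  mkseq (fun i => z ('C(n, 2) + i)%N) n.

Lemma bin2S n : 'C(n.+1, 2) = ('C(n, 2) + n)%N.
Proof. by rewrite binS bin1. Qed.

Lemma mkseq_block (z : nat -> bool) n :
  mkseq z 'C(n.+1, 2) = mkseq z 'C(n, 2) ++ block z n.
Proof.
rewrite bin2S /block /mkseq iotaD map_cat add0n.
by rewrite -[X in iota X n]addn0 iotaDl -map_comp.
Qed.

(** Each condition reads finitely many coordinates, and a point of the closure shares these with a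
    member of the set. *)
Lemma closed_blocks (m : nat) (P : nat -> seq (seq bool)) :
  closed [set z : cantor_space | forall n, (m <= n)%N -> block z n \in P n].
Proof.
move=> z clz n mn.
have [x [/(_ n mn) + /cylinder_mkseq]] := clz _ (cylinder_nbhs z 'C(n.+1, 2)).
rewrite !mkseq_block => + /eqP; rewrite eqseq_cat ?size_mkseq//.
by move=> + /andP[_ /eqP <-].
Qed.

(** The blocks occupy disjoint coordinates, so every further level at least halves the proportion of
    admissible initial segments. *)
Lemma null_blocks (R : realType) (m : nat) (P : nat -> seq (seq bool)) :
  (forall n, (m <= n)%N -> {in P n, forall s, size s = n}) ->
  (forall n, (m <= n)%N -> (size (P n) * 2 <= 2 ^ n)%N) ->
  cantor_measure R
    [set z : cantor_space | forall n, (m <= n)%N -> block z n \in P n] = 0%E.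
Proof.
move=> Pn sP; apply: cantor_measure_eq0 => j.
suff [T [TN sT zT]] : exists T : seq (seq bool),
    [/\ {in T, forall s, size s = 'C(m + j, 2)},
    (size T * 2 ^ j <= 2 ^ 'C(m + j, 2))%N &
    forall z : cantor_space, (forall n, (m <= n)%N -> block z n \in P n) ->
      mkseq z 'C(m + j, 2) \in T].
  exists T; first by exists 'C(m + j, 2).
  move=> z /zT zTj; exists (mkseq z 'C(m + j, 2)) => // i.
  by rewrite size_mkseq => ij; rewrite nth_mkseq.
elim: j => [|j [T [TN sT zT]]].
  exists [seq val t | t <- enum {: 'C(m, 2).-tuple bool}]; rewrite addn0; split.
  - by move=> _ /mapP[t _ ->]; rewrite size_tuple.
  - by rewrite size_map -cardE card_tuple card_bool muln1.
  - move=> z _; apply/mapP.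
    exists (Tuple (introT eqP (size_mkseq z 'C(m, 2)))) => //.
    by rewrite mem_enum.
exists [seq s ++ t | s <- T, t <- P (m + j)%N]; rewrite addnS bin2S; split.
- move=> _ /allpairsP[[s t] /= [sT' tP ->]].
  by rewrite size_cat TN// (Pn _ (leq_addr _ _) _ tP).
- rewrite size_allpairs expnSr mulnACA expnD.
  by apply: leq_mul => //; apply: sP; rewrite leq_addr.
- move=> z zP; rewrite -bin2S mkseq_block; apply: allpairs_f; first exact: zT.
  by apply: zP; rewrite leq_addr.
Qed.

Section Covered.
Variable R : realType.

Lemma closed_null_covered_sub (X Y : set cantor_space) :
  X `<=` Y -> closed_null_covered R Y -> closed_null_covered R X.
Proof. by move=> XY [F FP YF]; exists F => //; apply: subset_trans YF. Qed.

Lemma closed_null_set0 : closed (set0 : set cantor_space) /\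
  cantor_measure R set0 = 0%E.
Proof.
split; first exact: closed0.
apply: cantor_measure_eq0 => j; exists [::] => //.
by exists 0%N.
Qed.

Lemma closed_null_covered_bigcup (X : nat -> set cantor_space) :
  (forall n, closed_null_covered R (X n)) ->
  closed_null_covered R (\bigcup_n X n).
Proof.
move=> covX.
have /choice[F FP] n : exists F : nat -> set cantor_space,
    (forall i, closed (F i) /\ cantor_measure R (F i) = 0%E) /\
    X n `<=` \bigcup_i F i.
  by have [F ? ?] := covX n; exists F.
exists (fun k => if unpickle k is Some (n, i) then F n i else set0) => [k|].
  case: unpickle => [[n i]|]; last exact: closed_null_set0.
  by have [] := FP n.
move=> z [n _ /(FP n).2[i _ Fz]]; exists (pickle (n, i)) => //.
by rewrite pickleK.
Qed.

Lemma closed_null_covered_closed (F : set cantor_space) :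
  closed F -> cantor_measure R F = 0%E -> closed_null_covered R F.
Proof. by move=> cF F0; exists (fun=> F) => // z Fz; exists 0%N. Qed.

Lemma closed_null_covered1 (z : cantor_space) : closed_null_covered R [set z].
Proof.
apply: closed_null_covered_closed.
  by apply/accessible_closed_set1/hausdorff_accessible/cantor_space_hausdorff.
apply: cantor_measure_eq0 => j; exists [:: mkseq z j].
  exists j; last by rewrite mul1n.
  by move=> s; rewrite inE => /eqP ->; rewrite size_mkseq.
move=> _ ->; exists (mkseq z j); first by rewrite inE.
by move=> i; rewrite size_mkseq => ij; rewrite nth_mkseq.
Qed.

End Covered.

(** * The weight of a separable line *)

Section Weight.
Variables (d : Order.disp_t) (K : orderTopologicalType d) (e : nat -> K).
Hypothesis dense_e : dense (range e).

Definition gt_opt (l : option K) : set K :=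
  [set z | if l is Some l' then (l' < z)%O else True].

Definition lt_opt (r : option K) : set K :=
  [set z | if r is Some r' then (z < r')%O else True].

Lemma open_gt_opt l : open (gt_opt l).
Proof.
case: l => [l|]; last exact: openT.
suff -> : gt_opt (Some l) = `]l, +oo[%classic by exact: rray_open.
by apply/seteqP; split => z; rewrite /= in_itv /= andbT.
Qed.

Lemma open_lt_opt r : open (lt_opt r).
Proof.
case: r => [r|]; last exact: openT.
suff -> : lt_opt (Some r) = `]-oo, r[%classic by exact: lray_open.
by apply/seteqP; split => z; rewrite /= in_itv /=.
Qed.

Lemma nbhs_opt (x : K) (U : set K) : nbhs x U ->
  exists l r, [/\ gt_opt l x, lt_opt r x & gt_opt l `&` lt_opt r `<=` U].
Proof.
rewrite itv_nbhsE => -[[a b] [/= oab]]; rewrite itv_boundlr => /andP[ax xb] abU.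
pose l := if a is BRight a' then Some a' else None.
pose r := if b is BLeft b' then Some b' else None.
exists l, r; split.
- by rewrite /l /gt_opt; case: a ax {oab abU l} => [[] a'|[]].
- by rewrite /r /lt_opt; case: b xb {oab abU r} => [[] b'|[]].
move=> z [lz zr]; apply: abU; rewrite /= itv_boundlr.
move: oab lz zr; rewrite /l /r {l r ax xb}.
by case: a => [[] a'|[]]; case: b => [[] b'|[]] //=; rewrite /gt_opt /lt_opt /=
  ?bnd_simp => // _ *; apply/andP.
Qed.

Lemma jump_open y : jump y -> open [set z : K | (z <= y)%O].
Proof.
move=> [z yz zmin]; suff -> : [set w | (w <= y)%O] = lt_opt (Some z).
  exact: open_lt_opt.
apply/seteqP; split => w /= wy; first exact: le_lt_trans yz.
by case: leP => // /zmin; rewrite leNgt wy.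
Qed.

(* An interval cut out by two jumps is a singleton, hence already listed as
   some [[set e j]]; so every family has at most one parameter in [K]. *)
Definition base_index : Type :=
  (option nat * option nat + nat + (option nat + option nat))%type.
HB.instance Definition _ := Countable.on base_index.

Definition base_set (i : base_index) (y : K) : set K :=
  match i with
  | inl (inl (l, r)) => gt_opt (omap e l) `&` lt_opt (omap e r)
  | inl (inr j) => [set e j]
  | inr (inl l) => gt_opt (omap e l) `&` [set z | (z <= y)%O]
  | inr (inr r) => gt_opt (Some y) `&` lt_opt (omap e r)
  end.

Definition base_dom (i : base_index) : set K :=
  if i is inl _ then setT else jump (K := K).

(** Openness is imposed because a singleton [[set e j]] may fail to be open. *)
Definition small_base : set (set K) :=
  [set U | open U /\ exists i, (base_set i @` base_dom i) U].

(** An end of an order interval around [x] can be moved to a term of [e] unless nothing lies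
    strictly between it and [x]. In that case the left end is a jump with successor [x],
    respectively [x] itself is a jump. *)
Lemma small_base_basis : basis small_base.
Proof.
split => [U []//|x U /nbhs_opt[l [r [lx xr lrU]]]].
suff [V [oV Vx VU [i [y [iy yV]]]]] : exists V, [/\ open V, V x,
    V `<=` gt_opt l `&` lt_opt r & exists i y, base_dom i y /\ base_set i y = V].
  exists V; last by move=> z /VU/lrU.
  by split=> //; split => //; exists i, y.
have left : (exists2 o, gt_opt (omap e o) x & gt_opt (omap e o) `<=` gt_opt l) \/
   (exists y, [/\ jump y, (y < x)%O, forall w, (y < w)%O -> (x <= w)%O &
     gt_opt (Some y) `<=` gt_opt l]).
  case: l lx {lrU} => [l|] lx; last by left; exists None.
  have [[w [lw wx]]|nw] := pselect (exists w, (l < w)%O /\ (w < x)%O).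
    have [j [lj jx]] := dense_itv dense_e lw wx.
    by left; exists (Some j) => // z; exact: lt_trans.
  have xmin w : (l < w)%O -> (x <= w)%O.
    by move=> lw; case: leP => // wx; by case: nw; exists w.
  by right; exists l; split => //; exists x.
have right : (exists2 o, lt_opt (omap e o) x & lt_opt (omap e o) `<=` lt_opt r) \/
   (jump x /\ [set z | (z <= x)%O] `<=` lt_opt r).
  case: r xr {lrU} => [r|] xr; last by left; exists None.
  have [[w [xw wr]]|nw] := pselect (exists w, (x < w)%O /\ (w < r)%O).
    have [j [xj jr]] := dense_itv dense_e xw wr.
    by left; exists (Some j) => // z /= zj; exact: lt_trans jr.
  right; split; last by move=> z /= zx; exact: le_lt_trans xr.
  exists r => // w xw; case: leP => // wr; by case: nw; exists w.
case: left => [[i ix il]|[y [jy yx xmin yl]]];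
  case: right => [[i' i'x i'r]|[jx xr']].
- exists (base_set (inl (inl (i, i'))) x); split => //.
  + by apply: openI; [exact: open_gt_opt|exact: open_lt_opt].
  + exact: setISS.
  + by exists (inl (inl (i, i'))), x.
- exists (base_set (inr (inl i)) x); split => //.
  + by apply: openI; [exact: open_gt_opt|exact: jump_open].
  + by split => //=.
  + exact: setISS.
  + by exists (inr (inl i)), x.
- exists (base_set (inr (inr i')) y); split => //.
  + by apply: openI; [exact: open_gt_opt|exact: open_lt_opt].
  + exact: setISS.
  + by exists (inr (inr i')), y.
(* Both ends are blocked, so [x] is isolated and density makes it a term of [e]. *)
- have x1 : gt_opt (Some y) `&` [set z | (z <= x)%O] = [set x].
    apply/seteqP; split => [z [/= /xmin xz zx]|_ ->]; last by split => /=.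
    by apply/eqP; rewrite eq_le zx.
  have o1 : open [set x].
    by rewrite -x1; apply: openI; [exact: open_gt_opt|exact: jump_open].
  have [|z [zx [j _ jz]]] := dense_e _ o1; first by exists x.
  exists [set x]; split => //.
  + by rewrite -x1; exact: setISS.
  + by exists (inl (inr j)), x; split => //=; rewrite jz zx.
Qed.

Lemma uncovered_jumps (R : realType) (B : set (set K)) (X : set cantor_space) :
  weight_attained B -> ~ closed_null_covered R X -> X #<= B ->
  exists h : K -> cantor_space, ~ closed_null_covered R (h @` jump (K := K)).
Proof.
move=> [_ minB] ncovX XB.
have /pcard_leP/injfunPex[g gB ginj] : X #<= small_base.
  exact: card_le_trans XB (minB _ small_base_basis).
pose part i := [set x | X x /\ (base_set i @` base_dom i) (g x)].
(* Covered sets form a sigma-ideal, so one of the countably many one-parameter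
   families is enough and no cardinal arithmetic is needed. *)
have [i ncov] : exists i, ~ closed_null_covered R (part i).
  apply: contrapT => cov; apply: ncovX.
  apply: (@closed_null_covered_sub _ _
      (\bigcup_n (if unpickle n is Some i then part i else set0))).
    move=> x Xx; have [_ [i gi]] := gB x Xx.
    by exists (pickle i) => //; rewrite pickleK.
  apply: closed_null_covered_bigcup => n; case: unpickle => [i|].
    by apply: contrapT => ncov; apply: cov; exists i.
  by have [? ?] := closed_null_set0 R; exact: closed_null_covered_closed.
(* [h y] is the element of [X] that [g] sends to [base_set i y], when there is one; by injectivity
   of [g] the image of the jumps then contains [part i]. *)
exists (fun y => xget point [set x | X x /\ base_set i y = g x]) => cov.
apply: ncov; case: i cov => [c|f] cov; last first.
  apply: closed_null_covered_sub cov => x [Xx [y jy yx]]; exists y => //.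
  have [Xx' yx'] := xgetPex point
    (ex_intro (fun x => X x /\ base_set (inr f) y = g x) x (conj Xx yx)).
  by apply: ginj; rewrite ?inE// -yx' yx.
(* For an index [inl c] the set [base_set] is independent of [y], so [part] has at most one point
   and is covered. *)
have [[x cx]|cN] := pselect (exists x, part (inl c) x); last first.
  apply: (closed_null_covered_sub _ (closed_null_covered1 R point)) => x cx.
  by case: cN; exists x.
apply: (closed_null_covered_sub _ (closed_null_covered1 R x)) => x' [Xx' [y' _ yx']].
have [Xx [y _ yx]] := cx.
apply: ginj; rewrite ?inE// -yx -yx'.
by case: (c).
Qed.
End Weight.

(** * Extension operators *)

Section SupNorm.
Variables (R : realType) (T : topologicalType).

Lemma sup_norm_ge (f : T -> R) (x : T) (c : R) :
  (forall y, `|f y| <= c) -> `|f x| <= sup_norm f.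
Proof.
by move=> fc; apply: ub_le_sup; [exists c => _ [y _ <-]|exists x].
Qed.

Lemma compact_sup_norm_ge (f : T -> R) (x : T) :
  compact [set: T] -> continuous f -> `|f x| <= sup_norm f.
Proof.
move=> cT cf; have : compact (f @` [set: T]).
  by apply: continuous_compact => //; exact: continuous_subspaceT.
move/compact_bounded => [M [_ MP]].
apply: (@sup_norm_ge _ _ (M + 1)) => y; apply: (MP (M + 1)); last by exists y.
by rewrite ltrDl.
Qed.

Lemma sup_norm_le (f : T -> R) (x : T) (c : R) :
  (forall y, `|f y| <= c) -> sup_norm f <= c.
Proof.
move=> fc; apply: ge_sup; first by exists `|f x|; exists x.
by move=> _ [y _ <-].
Qed.

End SupNorm.

Lemma clopen_indicator_continuous (R : realType) (T : topologicalType)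
    (A : set T) (f : T -> R) : open A -> open (~` A) ->
  (forall x, A x -> f x = 1) -> (forall x, ~ A x -> f x = 0) -> continuous f.
Proof.
move=> oA oA' f1 f0 x; have [Ax|nAx] := pselect (A x).
  rewrite /continuous_at f1 //; apply: cvg_near_cst; near=> y.
  by apply: f1; near: y; exact: open_nbhs_nbhs.
rewrite /continuous_at f0 //; apply: cvg_near_cst; near=> y.
by apply: f0; near: y; exact: open_nbhs_nbhs.
Unshelve. all: by end_near. Qed.

Lemma open_near_functions (R : realType) (T : topologicalType) (f g : T -> R)
    (c : R) :
  continuous f -> continuous g -> open [set x | `|f x - g x| < c].
Proof.
move=> cf cg.
have cfg : continuous (fun x => f x - g x).
  by move=> x; apply: cvgB; [exact: cf|exact: cg].
have -> : [set x | `|f x - g x| < c] = (fun x => f x - g x) @^-1` ball (0 : R) c.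
  by apply/seteqP; split => x; rewrite /ball /= sub0r normrN.
by apply: open_comp => [x _|]; [exact: cfg|exact: ball_open].
Qed.

(** * Variation of the extended segments along chains of jumps *)

Fixpoint path_variation (R : realType) (T : Type) (phi : T -> R) (a : T) (s : seq T)
    : R :=
  if s is b :: s' then `|phi b - phi a| + path_variation phi b s' else 0.

Section Operator.
Variables (R : realType) (d : Order.disp_t) (K : orderTopologicalType d).
Variables (L : topologicalType) (E : (K -> R) -> (L -> R)) (M : R).
Hypothesis cptL : compact [set: L].
Hypothesis E_continuous : forall f : K -> R, continuous f -> continuous (E f).
Hypothesis E_linear : forall (a : R) (f g : K -> R), continuous f ->
  continuous g -> E (a *: f + g) = a *: E f + E g.
Hypothesis E_bounded : forall f : K -> R, continuous f ->
  sup_norm (E f) <= M * sup_norm f.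

Definition segment (y : K) : K -> R := fun z => (z <= y)%O%:R.

Lemma segment_continuous y : jump y -> continuous (segment y).
Proof.
move=> jy; apply: (@clopen_indicator_continuous _ _ [set z | (z <= y)%O]).
- exact: jump_open.
- suff -> : ~` [set z | (z <= y)%O] = `]y, +oo[%classic by exact: rray_open.
  by apply/seteqP; split => z; rewrite /= in_itv /= andbT ltNge => /negP.
- by move=> z /= zy; rewrite /segment zy.
- by move=> z /= /negP/negbTE zy; rewrite /segment zy.
Qed.

Lemma E_zero : E 0 = 0.
Proof.
have c0 : continuous (0 : K -> R) by move=> x; exact: cvg_cst.
have := E_linear 1 c0 c0; rewrite !scale1r addr0 => /eqP.
by rewrite -subr_eq0 opprD addrA subrr sub0r oppr_eq0 => /eqP.
Qed.

(** A signed sum of the indicators of consecutive half-open intervals; the signs turn the value at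
    [p] of its extension into the variation along the path. *)
Fixpoint signed_steps (p : L) (a : K) (s : seq K) : K -> R :=
  if s is b :: s' then
    Num.sg (E (segment b) p - E (segment a) p) *: (segment b - segment a) +
      signed_steps p b s'
  else 0.

Lemma signed_steps_continuous p a s : {in a :: s, forall y, jump y} ->
  continuous (signed_steps p a s).
Proof.
elim: s a => [|b s IH] a js; first by move=> x; exact: cvg_cst.
have cb : continuous (segment b).
  by apply/segment_continuous/js; rewrite !inE eqxx orbT.
have ca : continuous (segment a).
  by apply/segment_continuous/js; rewrite inE eqxx.
move=> x; apply: cvgD; last first.
  by apply: IH => y ys; apply: js; rewrite inE ys orbT.
by apply: cvgZl_tmp; apply: cvgB; [exact: cb|exact: ca].
Qed.

Lemma E_signed_steps p a s : {in a :: s, forall y, jump y} ->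
  E (signed_steps p a s) p = path_variation (fun y => E (segment y) p) a s.
Proof.
elim: s a => [|b s IH] a js /=; first by rewrite E_zero.
have cb : continuous (segment b).
  by apply/segment_continuous/js; rewrite !inE eqxx orbT.
have ca : continuous (segment a).
  by apply/segment_continuous/js; rewrite inE eqxx.
have js' : {in b :: s, forall y, jump y}.
  by move=> y ys; apply: js; rewrite inE ys orbT.
have cba : continuous (segment b - segment a : K -> R).
  by move=> x; apply: cvgB; [exact: cb|exact: ca].
rewrite E_linear //; last exact: signed_steps_continuous.
have -> : E (segment b - segment a) = E (segment b) - E (segment a).
  by rewrite addrC -scaleN1r E_linear // scaleN1r addrC.
rewrite -IH //; congr (_ + _).
exact: esym (normrEsg _).
Qed.

Lemma signed_stepsE p a b s z : signed_steps p a (b :: s) z =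
  Num.sg (E (segment b) p - E (segment a) p) * (segment b z - segment a z) +
    signed_steps p b s z.
Proof. by []. Qed.

Lemma signed_steps_eq0 p a s z : path <%O a s -> (z <= a)%O ->
  signed_steps p a s z = 0.
Proof.
elim: s a => [//|b s IH] a /andP[ab bs] za.
have zb : (z <= b)%O := le_trans za (ltW ab).
by rewrite signed_stepsE IH // /segment za zb subrr mulr0 addr0.
Qed.

(** Along an increasing path the half-open intervals are disjoint, so at most one summand is nonzero
    at [z]. *)
Lemma signed_steps_le1 p a s z : path <%O a s -> `|signed_steps p a s z| <= 1.
Proof.
elim: s a => [|b s IH] a; first by rewrite normr0.
move=> /andP[ab bs]; rewrite signed_stepsE /segment.
have [zb|bz] := leP z b.
  rewrite signed_steps_eq0 // addr0 normrM -[leRHS]mulr1.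
  apply: ler_pM => //; first by rewrite normr_sg lern1 leq_b1.
  by case: (z <= a)%O; rewrite ?subrr ?subr0 ?normr0 ?normr1.
by rewrite [(z <= a)%O]leNgt (lt_trans ab bz) subrr mulr0 add0r; exact: IH.
Qed.

(** The variation is the value at [p] of the extension of a function of norm at most 1, whatever the
    length of the path. The absolute value appears because the sign of [M] is not prescribed. *)
Lemma variation_bound p a s : path <%O a s -> {in a :: s, forall y, jump y} ->
  path_variation (fun y => E (segment y) p) a s <= `|M|.
Proof.
move=> pas js; rewrite -E_signed_steps //.
have cs := signed_steps_continuous (p := p) js.
apply: le_trans (ler_norm _) _.
apply: le_trans (compact_sup_norm_ge _ cptL (E_continuous cs)) _.
apply: le_trans (E_bounded cs) _.
apply: le_trans (ler_norm _) _; rewrite normrM -[leRHS]mulr1.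
apply: ler_wpM2l => //; rewrite ger0_norm.
  by apply: (sup_norm_le a) => y; exact: signed_steps_le1.
apply: le_trans (normr_ge0 _) (@sup_norm_ge _ _ _ a 1 _) => y.
exact: signed_steps_le1.
Qed.

End Operator.

(** Level [n] has [n] anchors with at most [n * n + 1] patterns each, to be compared with half of
    [2 ^ n]. At 12 this reads 3480 against 4096; at 11 it fails. *)
Lemma cubic_lt_exp2 n : (12 <= n)%N -> (n * (n * n + 1) * 2 <= 2 ^ n)%N.
Proof.
elim: n => // n IHn; rewrite leq_eqVlt => /predU1P[<- //|].
rewrite ltnS => n12; rewrite expnS; have := IHn n12; nia.
Qed.

(** * Counting the block patterns that an extension operator allows *)

Section NoOperator.
Variables (R : realType) (d : Order.disp_t) (K : orderTopologicalType d).
Variables (e : nat -> K) (h : K -> nat -> bool).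
Hypotheses (cptK : compact [set: K]) (dense_e : dense (range e)).

Local Notation L := (ext_space e h).

Definition point_at n (j i : 'I_n) : triple :=
  existT (fun n => ('I_n * 'I_n)%type) n (j, i).

(** The open ray below the successor of [y] contains some [e j0], which is then at most [y]. Past
    level [j0] the largest such term among the first [n] is the anchor. *)
Lemma cell_exists (y : K) : jump y -> exists n0, forall n, (n0 <= n)%N ->
  exists j : 'I_n, forall i, cell e (point_at j i) y.
Proof.
move=> [z yz zmin]; have oz := @lray_open _ K z.
have [|w [wz [j0 _ ej0]]] := dense_e _ oz.
  by exists y; rewrite /= in_itv.
have j0y : (e j0 <= y)%O.
  rewrite leNgt; apply/negP => /zmin; rewrite leNgt.
  by move: wz; rewrite -ej0 /= in_itv /= => ->.
exists j0.+1 => n jn.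
case: (@Order.TotalTheory.arg_maxP _ K 'I_n (Ordinal jn)
  (fun j => (e j <= y)%O) e j0y) => j jy jmax.
exists j => i; rewrite /cell /anchor /= jy /=.
by apply/forallP => j'; apply/implyP; exact: jmax.
Qed.

Lemma block_neq (u v : nat -> bool) n : block u n <> block v n ->
  exists i : 'I_n, u ('C(n, 2) + i)%N <> v ('C(n, 2) + i)%N.
Proof.
move=> uv; apply: contrapT => nuv; apply: uv.
apply: (@eq_from_nth _ false) => [|i]; rewrite !size_mkseq // => i_n.
rewrite !nth_mkseq //; apply: contrapT => ne; apply: nuv.
by exists (Ordinal i_n).
Qed.

Variables (E : (K -> R) -> (L -> R)) (M : R).
Hypothesis E_continuous : forall f : K -> R, continuous f -> continuous (E f).
Hypothesis E_linear : forall (a : R) (f g : K -> R), continuous f ->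
  continuous g -> E (a *: f + g) = a *: E f + E g.
Hypothesis E_bounded : forall f : K -> R, continuous f ->
  sup_norm (E f) <= M * sup_norm f.
Hypothesis E_extends : forall f : K -> R, continuous f -> E f \o inl = f.

(** With error below 1/4, opposite bits force values more than 1/2 apart. *)
Definition close (k : triple) (y : K) : Prop :=
  `|E (segment R y) (inr k) - (left_of e h k y)%:R| < 4^-1.

(** The extension by [E] and the indicator of [left_cut y] are continuous and agree on [K], so they
    are within 1/4 on an open set containing [K], which omits only triples of bounded level. *)
Lemma eventually_close (y : K) : jump y ->
  exists n, forall k, (n <= tag k)%N -> close k y.
Proof.
move=> jy.
pose c (p : L) : R := `[< left_cut y p >]%:R.
have cc : continuous c.
  apply: (@clopen_indicator_continuous _ _ (left_cut y : set L)).
  - exact/ext_subbase_open/sub_cut.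
  - exact/ext_subbase_open/sub_cutC.
  - by move=> p yp; rewrite /c asboolT.
  - by move=> p yp; rewrite /c asboolF.
have ci := segment_continuous (R := R) jy.
pose W := [set p : L | `|E (segment R y) p - c p| < 4^-1].
have oW : open W by exact: open_near_functions (E_continuous ci) cc.
have KW : range inl `<=` W.
  move=> _ [z _ <-]; rewrite /W /= -[E _ _]/((E (segment R y) \o inl) z).
  rewrite E_extends //.
  rewrite /c /segment (_ : `[< _ >] = (z <= y)%O) ?subrr ?normr0 ?invr_gt0 //.
  by apply/asboolP/idP.
have [n nW] := finite_outside dense_e cptK oW KW.
exists n => k /nW; rewrite /W /close /= (_ : c (inr k) = (left_of e h k y)%:R) //.
by rewrite /c (_ : `[< _ >] = left_of e h k y) //; apply/asboolP/idP.
Qed.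

(** Consecutive points have different blocks, hence differ in some bit [i], and the variation at the
    triple of that bit grows by at least 1/2. *)
Lemma variation_lower n (j : 'I_n) (a : K) (s : seq K) :
  {in a :: s, forall y, (forall i, close (point_at j i) y) /\
     forall i, cell e (point_at j i) y} ->
  {in a :: s &, injective (fun y => block (h y) n)} -> uniq (a :: s) ->
  (size s)%:R / 2 <=
    \sum_(i < n) path_variation (fun y => E (segment R y) (inr (point_at j i))) a s.
Proof.
elim: s a => [|b s IH] a ys hinj us.
  by rewrite mul0r; apply: sumr_ge0.
have {}IH : (size s)%:R / 2 <= \sum_(i < n)
    path_variation (fun y => E (segment R y) (inr (point_at j i))) b s.
  apply: IH.
  - by move=> y yb; apply: ys; rewrite inE yb orbT.
  - by move=> y y' yb yb'; apply: hinj; rewrite inE ?yb ?yb' orbT.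
  - by case/andP: us.
rewrite /= big_split /= -natr1 mulrDl mul1r addrC; apply: lerD => //.
have /block_neq[i hi] : block (h a) n <> block (h b) n.
  move=> /hinj; rewrite !inE !eqxx orbT => /(_ erefl erefl) ab.
  by case/andP: us; rewrite ab inE eqxx.
rewrite (bigD1 i) //= -[leLHS]addr0; apply: lerD; last exact: sumr_ge0.
have left_ofE y : y \in a :: b :: s ->
    left_of e h (point_at j i) y = h y ('C(n, 2) + i)%N.
  move=> /ys[_ /(_ i) cy]; rewrite /left_of cy /=.
  by case/andP: cy => ->.
have : close (point_at j i) b by apply: (ys b _).1; rewrite !inE eqxx orbT.
have : close (point_at j i) a by apply: (ys a _).1; rewrite inE eqxx.
rewrite /close !left_ofE ?inE ?eqxx ?orbT //.
set u := E _ _; set v := E _ _.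
rewrite !ltr_norml => ua vb.
case: (h a _) (h b _) hi ua vb => [] [] // _; rewrite /= ?mulr1n ?mulr0n =>
    /andP[u1 u2] /andP[v1 v2].
  by rewrite ler_normr; apply/orP; right; lra.
by rewrite ler_normr; apply/orP; left; lra.
Qed.

(** One jump is chosen per pattern. The steps between them, one fewer than the patterns, each cost
    1/2 of variation, while the [n] triples together allow at most [|M| * n]. *)
Lemma patterns_card (N n : nat) (j : 'I_n) (Y : set K) :
  `|M| * 2 <= N%:R ->
  (forall y, Y y -> jump y /\ forall i, close (point_at j i) y) ->
  (#|[set t : n.-tuple bool | `[< exists y, [/\ Y y,
      forall i, cell e (point_at j i) y & block (h y) n = t] >]]%SET| <=
    N * n + 1)%N.
Proof.
move=> MN Yok; set A := [set t | _]%SET.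
have /choice[rep repP] (t : n.-tuple bool) : exists y, t \in A -> [/\ Y y,
    forall i, cell e (point_at j i) y & block (h y) n = t].
  have [|nA] := boolP (t \in A); last by exists (e 0).
  by rewrite inE => /asboolP[y yP]; exists y.
(* Sorting makes the representatives an increasing path, as the upper bound on the variation
   requires. *)
pose s := sort <=%O [seq rep t | t <- enum A].
have sA y : y \in s -> [/\ Y y, forall i, cell e (point_at j i) y &
    exists2 t, t \in A & y = rep t].
  rewrite mem_sort => /mapP[t]; rewrite mem_enum => tA ->.
  by have [? ? _] := repP t tA; split => //; exists t.
have us : uniq s.
  rewrite sort_uniq map_inj_in_uniq ?enum_uniq // => t t'.
  rewrite !mem_enum => tA tA' tt'; apply: val_inj => /=.
  by have [_ _ <-] := repP t tA; have [_ _ <-] := repP t' tA'; rewrite tt'.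
have lts : sorted <%O s by rewrite sort_lt_sorted -(sort_uniq <=%O).
have ss : size s = #|A| by rewrite size_sort size_map -cardE.
case: s sA us lts ss => [|a s] sA us lts; first by move=> <-.
move=> <- /=; rewrite addn1 ltnS -(ler_nat R) natrM.
apply: le_trans (_ : `|M| * n%:R * 2 <= _); last first.
  by rewrite mulrAC ler_wpM2r.
rewrite -ler_pdivrMr //.
apply: le_trans (@variation_lower n j a s _ _ us) _.
- by move=> y /sA[/Yok[_ ?] ? _].
- move=> y y' /sA[_ _ [t tA ->]] /sA[_ _ [t' tA' ->]].
  have [_ _ ->] := repP t tA; have [_ _ ->] := repP t' tA'.
  by move=> /val_inj ->.
rewrite mulr_natr -[leRHS](_ : \sum_(i < n) `|M| = _); last first.
  by rewrite sumr_const card_ord.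
apply: ler_sum => i _; have cptL := @ext_compact _ _ e h dense_e cptK.
apply: (variation_bound cptL E_continuous E_linear E_bounded) => //.
by move=> y /sA[/Yok[]].
Qed.

Lemma covered_jumps :
  closed_null_covered R ((h : K -> cantor_space) @` jump (K := K)).
Proof.
have [N MN] : exists N, `|M| * 2 <= N%:R :> R.
  by exists (Num.bound (`|M| * 2)); apply/ltW/archi_boundP; rewrite mulr_ge0.
(* The level from which [h y] is controlled depends on [y]; the jumps are split into countably many
   stages with a uniform level. *)
pose Y m := [set y : K | jump y /\ forall n, (m <= n)%N ->
  (forall k, tag k = n -> close k y) /\
  exists j : 'I_n, forall i, cell e (point_at j i) y].
apply: (@closed_null_covered_sub _ _ (\bigcup_m ((h : K -> cantor_space) @` Y m))).
  move=> _ [y jy <-].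
  have [n1 n1P] := eventually_close jy; have [n2 n2P] := cell_exists jy.
  exists (maxn n1 n2) => //; exists y => //; split=> // n.
  rewrite geq_max => /andP[n1n n2n]; split; last exact: n2P.
  by move=> k kn; apply: n1P; rewrite kn.
apply: closed_null_covered_bigcup => m.
pose A n (j : 'I_n) := [set t : n.-tuple bool | `[< exists y, [/\ Y m y,
      forall i, cell e (point_at j i) y & block (h y) n = t] >]]%SET.
pose P n := [seq val t | t <- enum (\bigcup_(j < n) A n j)%SET].
(* [m] serves the stage, [N] gives [N * n <= n * n], and 12 starts the exponential bound. *)
pose m0 := maxn m (maxn N 12).
apply: (@closed_null_covered_sub _ _ [set z : cantor_space |
    forall n, (m0 <= n)%N -> block z n \in P n]).
  move=> _ [y Yy <-] n; rewrite geq_max => /andP[mn _].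
  have [_ [j jP]] := Yy.2 n mn.
  have sb : size (block (h y) n) = n by rewrite size_mkseq.
  apply/mapP; exists (Tuple (introT eqP sb)) => //.
  rewrite mem_enum; apply/bigcupP; exists j => //; rewrite inE.
  by apply/asboolP; exists y.
apply: closed_null_covered_closed; first exact: closed_blocks.
apply: null_blocks => n; rewrite !geq_max => /and3P[mn Nn n12].
  by move=> _ /mapP[t _ ->]; rewrite size_tuple.
rewrite size_map -cardE; apply: leq_trans (cubic_lt_exp2 n12).
rewrite leq_mul2r /=.
apply: (@leq_trans (\sum_(j < n) (n * n + 1))%N); last first.
  by rewrite sum_nat_const card_ord.
apply: (@leq_trans (\sum_(j < n) #|A n j|)%N).
  apply: (big_ind2 (fun (B : {set _}) k => #|B| <= k)%N); first by rewrite cards0.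
    move=> B k B' k' Bk Bk'; apply: leq_trans (leq_card_setU _ _) _.
    exact: leq_add.
  by [].
apply: leq_sum => j _; apply: leq_trans (_ : N * n + 1 <= _)%N; last first.
  by rewrite leq_add2r leq_mul2r Nn orbT.
apply: patterns_card => // y [jy yP]; split=> // i.
exact: (yP n mn).1.
Qed.

End NoOperator.

Lemma separable_dense_sequence (T : topologicalType) :
  [set: T] !=set0 -> separable_space T -> exists e : nat -> T, dense (range e).
Proof.
move=> [x0 _] [D /countable_injP[f finj] dD].
exists (fun n => xget x0 [set x | D x /\ f x = n]) => O O0 oO.
have [x [Ox Dx]] := dD O O0 oO; exists x; split=> //; exists (f x) => //.
have [Dy fy] := xgetPex x0
  (ex_intro (fun y => D y /\ f y = f x) x (conj Dx erefl)).
by apply: finj; rewrite ?inE.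
Qed.

Theorem corollary6p3 (R : realType) (d : Order.disp_t)
    (K : orderTopologicalType d) (B : set (set K)) (X : set cantor_space)
    (cptK : compact [set: K]) (sepK : separable_space K)
    (wB : weight_attained B) (nonX : nonE_attained R X)
    (nonE_le_weight : X #<= B) :
  exists (L : topologicalType) (i : K -> L),
    countable_discrete_extension i /\ ~ property_E R i.
Proof.
have [ncovX _] := nonX.
have [e dense_e] : exists e : nat -> K, dense (range e).
  apply: separable_dense_sequence sepK.
  (* If [K] were empty, the empty family would be a base, forcing [X] to be empty and thus
     covered. *)
  apply: contrapT => K0; apply: ncovX.
  have B0 : basis (set0 : set (set K)) by split=> // x; case: K0; exists x.
  have [_ /(_ _ B0) BK] := wB.
  have /card_le0P -> := card_le_trans nonE_le_weight BK.
  by have [? ?] := closed_null_set0 R; exact: closed_null_covered_closed.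
have [h ncov] := uncovered_jumps dense_e wB ncovX nonE_le_weight.
exists (ext_space e h), inl; split; first exact: ext_extension.
move=> [E [Ec El [M Eb] Ee]]; apply: ncov.
exact: (covered_jumps cptK dense_e Ec El Eb Ee).
Qed.
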